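(* Every closed $\widetilde{\mathbb{C}}$-linear map from a barrelled $\widetilde{\mathbb{C}}$-module $(\mathcal{G},\tau_1)$ to a Fréchet $\widetilde{\mathbb{C}}$-module $(\mathcal{F},\tau_2)$ is continuous.
   Context: A map is closed if its graph is closed in the product space $\mathcal{G}\times\mathcal{F}$. Generalized numbers: $\widetilde{\mathbb{C}}=\mathcal{E}_M/\mathcal{N}$, where $\mathcal{E}_M$ is the ring of nets $(c_\varepsilon)_\varepsilon\in\mathbb{C}^{(0,1]}$ with $|c_\varepsilon|=O(\varepsilon^{-N})$ as $\varepsilon\to0$ for some $N\in\mathbb{N}$, and $\mathcal{N}$ is the ideal of nets with $|c_\varepsilon|=O(\varepsilon^{q})$ for all $q\in\mathbb{N}$; $[(c_\varepsilon)_\varepsilon]$ denotes the class of $(c_\varepsilon)_\varepsilon$. The valuation is $\mathrm{v}(c)=\sup\{b\in\mathbb{R}: |c_\varepsilon|=O(\varepsilon^b)\text{ as }\varepsilon\to0\}$ and $|c|_{\mathrm e}=e^{-\mathrm{v}(c)}$; $\widetilde{\mathbb{C}}$ carries the topology of the ultrametric $|c-d|_{\mathrm e}$. A topological $\widetilde{\mathbb{C}}$-module is a $\widetilde{\mathbb{C}}$-module with a ($\widetilde{\mathbb{C}}$-linear) topology making addition and scalar multiplication $\widetilde{\mathbb{C}}\times\mathcal{G}\to\mathcal{G}$ continuous. A subset $A$ of a $\widetilde{\mathbb{C}}$-module $\mathcal{G}$ is balanced if $\lambda A\subseteq A$ whenever $|\lambda|_{\mathrm e}\le1$; absorbent if for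 every $u\in\mathcal{G}$ there is $a\in\mathbb{R}$ with $u\in[(\varepsilon^b)_\varepsilon]A$ for all $b\le a$; convex if $A+A\subseteq A$ and $[(\varepsilon^b)_\varepsilon]A\subseteq A$ for all $b\ge0$. A topological $\widetilde{\mathbb{C}}$-module is locally convex if it has a base of convex neighborhoods of $0$. A Fréchet $\widetilde{\mathbb{C}}$-module is a complete metrizable locally convex topological $\widetilde{\mathbb{C}}$-module. A string in $\mathcal{G}$ is a sequence $(U_n)_{n\ge1}$ of balanced and absorbent subsets of $\mathcal{G}$ (its knots) with $U_{n+1}+U_{n+1}\subseteq U_n$ for all $n$ and $[(\varepsilon^{-n})_\varepsilon]U_{n+p}\subseteq U_p$ for all $n,p\ge1$. In a topological $\widetilde{\mathbb{C}}$-module a string is closed if every knot is closed, and topological if every knot is a neighborhood of $0$. A topological $\widetilde{\mathbb{C}}$-module is barrelled if every closed string in it is topological. *)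

(* Defs.v *)
From HB Require Import structures.
From mathcomp Require Import all_boot all_order all_algebra.
From mathcomp Require Import generic_quotient ring_quotient complex.
From mathcomp Require Import all_classical all_reals all_analysis.

Set Implicit Arguments.
Unset Strict Implicit.
Unset Printing Implicit Defensive.

Import Order.TTheory GRing.Theory Num.Theory.
Import numFieldNormedType.Exports.
Import Quotient Normc.

Local Open Scope classical_set_scope.
Local Open Scope ring_scope.
Local Open Scope complex_scope.
Local Open Scope quotient_scope.

Section Nets.
Variable R : realType.

Definition unit_itv : Type := {e : R | 0 < e <= 1}.

HB.instance Definition _ := Choice.on unit_itv.

Fact unit_itv1 : 0 < (1 : R) <= 1.
Proof. by rewrite ltr01 lexx. Qed.

HB.instance Definition _ := isPointed.Build unit_itv (exist _ 1 unit_itv1).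

Definition net : Type := unit_itv -> R[i].

HB.instance Definition _ := GRing.ComNzRing.on net.

(* `|c_e| = O(e ^ b) as e -> 0 *)
Definition net_bigO (c : net) (b : R) : Prop :=
  exists k d : R, 0 < d /\
    forall e : unit_itv, sval e < d -> normc (c e) <= k * sval e `^ b.

Definition moderate : {pred net} :=
  fun c => `[< exists N : nat, net_bigO c (- N%:R) >].

Lemma moderateP c :
  reflect (exists N : nat, net_bigO c (- N%:R)) (c \in moderate).
Proof. exact: asboolP. Qed.

Lemma normc_ge0 (z : R[i]) : 0 <= normc z.
Proof. by case: z => a b; exact: sqrtr_ge0. Qed.

Lemma net_bigO_abs c b : net_bigO c b ->
  exists k d : R, [/\ 0 <= k, 0 < d &
    forall e : unit_itv, sval e < d -> normc (c e) <= k * sval e `^ b].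
Proof.
move=> [k [d [d0 H]]]; exists `|k|, d; split => // e ed.
by rewrite (le_trans (H e ed))// ler_wpM2r ?powR_ge0// ler_norm.
Qed.

Lemma net_bigO_le c b b' : b' <= b -> net_bigO c b -> net_bigO c b'.
Proof.
move=> bb' /net_bigO_abs[k [d [k0 d0 H]]]; exists k, d; split=> [|e ed]; first by [].
by rewrite (le_trans (H e ed))// ler_wpM2l// ger_powR//; exact: (svalP e).
Qed.

Lemma net_bigO0 b : net_bigO 0 b.
Proof.
exists 0, 1; split => // e _.
by rewrite mul0r; have -> : (0 : net) e = 0 by []; rewrite normc0.
Qed.

Lemma net_bigOD c c' b : net_bigO c b -> net_bigO c' b -> net_bigO (c + c') b.
Proof.
move=> [k [d [d0 H]]] [k' [d' [d'0 H']]].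
exists (k + k'), (Num.min d d'); split; first by rewrite lt_min d0.
move=> e; rewrite lt_min => /andP[ed ed'].
rewrite mulrDl (le_trans (le_normcD (c e) (c' e)))// lerD//.
- exact: H.
- exact: H'.
Qed.

Lemma net_bigON c b : net_bigO c b -> net_bigO (- c) b.
Proof.
move=> [k [d [d0 H]]]; exists k, d; split=> [|e ed]; first by [].
have -> : normc ((- c) e) = normc (c e) by exact: (normcN (c e : Rcomplex R)).
exact: H.
Qed.

Lemma net_bigOM c c' b b' :
  net_bigO c b -> net_bigO c' b' -> net_bigO (c * c') (b + b').
Proof.
move=> /net_bigO_abs[k [d [k0 d0 H]]] /net_bigO_abs[k' [d' [k'0 d'0 H']]].
exists (k * k'), (Num.min d d'); split; first by rewrite lt_min d0.
move=> e; rewrite lt_min => /andP[ed ed'].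
have /andP[e0 _] := svalP e.
rewrite powRD; last by rewrite (gt_eqF e0) implybT.
have -> : normc ((c * c') e) = normc (c e) * normc (c' e) by exact: normcM.
rewrite mulrACA ler_pM ?normc_ge0//.
- exact: H.
- exact: H'.
Qed.

Lemma net_bigO1 : net_bigO 1 0.
Proof.
exists 1, 1; split => // e _.
have -> : (1 : net) e = 1 by [].
by rewrite normc1 powRr0 mulr1.
Qed.

Lemma net_bigO1_le b : net_bigO 1 b -> b <= 0.
Proof.
move=> /net_bigO_abs[k [d [k0 d0 H]]]; rewrite leNgt; apply/negP => b0.
pose e := Num.min (d / 2) ((k + 1) `^ (- b^-1)).
have kb0 : 0 < (k + 1) `^ (- b^-1) by rewrite powR_gt0// ltr_wpDl.
have e0 : 0 < e by rewrite lt_min kb0 divr_gt0.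
have kb : (k + 1) `^ (- b^-1) <= 1.
  rewrite powRN invf_le1 ?powR_gt0 ?ltr_wpDl//.
  have k1 : 1 <= k + 1 by rewrite lerDr.
  have b'0 : 0 <= b^-1 by rewrite invr_ge0 ltW.
  by have := ler_powR k1 b'0; rewrite powRr0.
have e1 : 0 < e <= 1 by rewrite e0/= ge_min kb orbT.
have /(H (exist _ e e1)) : sval (exist (fun e : R => 0 < e <= 1) e e1) < d.
  by rewrite /= gt_min ltr_pdivrMr// ltr_pMr// ltr1n.
have -> : (1 : net) (exist _ e e1) = 1 by [].
rewrite normc1 /=; apply/negP; rewrite -ltNge.
have eb : e `^ b <= (k + 1)^-1.
  apply: (@le_trans _ _ (((k + 1) `^ (- b^-1)) `^ b)).
    have ekb : e <= (k + 1) `^ (- b^-1) by rewrite ge_min lexx orbT.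
    by rewrite ge0_ler_powR ?nnegrE ?(ltW b0) ?(ltW e0) ?(ltW kb0).
  by rewrite -powRrM mulNr mulVf ?gt_eqF// powR_inv1// addr_ge0.
rewrite (@le_lt_trans _ _ (k * (k + 1)^-1))// ?ler_wpM2l//.
by rewrite ltr_pdivrMr ?ltr_wpDl// mul1r ltrDl.
Qed.

Fact moderate_subring : subring_closed moderate.
Proof.
split.
- by apply/moderateP; exists 0%N; rewrite oppr0; exact: net_bigO1.
- move=> c c' /moderateP[N H] /moderateP[N' H']; apply/moderateP.
  exists (N + N')%N; apply: net_bigOD.
    by apply: net_bigO_le H; rewrite lerN2 ler_nat leq_addr.
  by apply/net_bigON; apply: net_bigO_le H'; rewrite lerN2 ler_nat leq_addl.
- move=> c c' /moderateP[N H] /moderateP[N' H']; apply/moderateP.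
  by exists (N + N')%N; rewrite natrD opprD; exact: net_bigOM.
Qed.

HB.instance Definition _ :=
  GRing.isSubringClosed.Build net moderate moderate_subring.

Record moderate_net := ModerateNet {
  mnet :> net ;
  mnetP : mnet \in moderate }.

HB.instance Definition _ := [isSub for mnet].
HB.instance Definition _ := [Choice of moderate_net by <:].
HB.instance Definition _ := [SubChoice_isSubComNzRing of moderate_net by <:].

Definition negligible : {pred moderate_net} :=
  fun c => `[< forall q : nat, net_bigO c q%:R >].

Lemma negligibleP (c : moderate_net) :
  reflect (forall q : nat, net_bigO c q%:R) (c \in negligible).
Proof. exact: asboolP. Qed.

Fact negligible_idealr : idealr_closed negligible.
Proof.
split.
- by apply/negligibleP => q; exact: net_bigO0.
- apply/negP => /negligibleP/(_ 1%N)/net_bigO1_le.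
  by rewrite leNgt ltr01.
- move=> a u v /negligibleP Hu /negligibleP Hv; apply/negligibleP => q.
  have /moderateP[N HN] := mnetP a.
  apply: net_bigOD; last exact: Hv.
  apply: net_bigO_le (net_bigOM HN (Hu (N + q)%N)).
  by rewrite natrD addKr.
Qed.

HB.instance Definition _ :=
  isIdealr.Build moderate_net negligible negligible_idealr.

Definition gencomplex : Type := {quot negligible}.

HB.instance Definition _ := GRing.ComNzRing.on gencomplex.

Definition gclass (c : moderate_net) : gencomplex := \pi_({quot negligible}) c.

Definition grepr (c : gencomplex) : moderate_net := repr (c : {quot negligible}).

Lemma greprK : cancel grepr gclass.
Proof. exact: reprK. Qed.

Lemma gclass_eq (c c' : moderate_net) :
  gclass c = gclass c' <-> c - c' \in negligible.
Proof.
rewrite (idealrBE (negligible : zmodClosed _)).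
by split => [?|/eqP//]; apply/eqP.
Qed.

Lemma gclassD (c c' : moderate_net) : gclass (c + c') = gclass c + gclass c'.
Proof. exact: (@pi_add _ (negligible : zmodClosed _)). Qed.

Lemma gclass0 : gclass 0 = 0.
Proof. by apply: (@addrI _ (gclass 0)); rewrite -gclassD !addr0. Qed.

Lemma gclassN (c : moderate_net) : gclass (- c) = - gclass c.
Proof. exact: (@pi_opp _ (negligible : zmodClosed _)). Qed.

Lemma gclassM (c c' : moderate_net) : gclass (c * c') = gclass c * gclass c'.
Proof. exact: (@pi_mul _ (negligible : idealr _)). Qed.

Definition net_val (c : net) : \bar R :=
  ereal_sup [set b%:E | b in net_bigO c].

Definition gval (c : gencomplex) : \bar R := net_val (grepr c).

Definition enorm (c : gencomplex) : R := fine (expeR (- gval c)%E).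

Lemma negligible_bigO (c : moderate_net) b : c \in negligible -> net_bigO c b.
Proof.
move=> /negligibleP/(_ (Num.bound `|b|)); apply: net_bigO_le.
by rewrite (le_trans (ler_norm b))// ltW// archi_boundP.
Qed.

Lemma gclass_bigO (c c' : moderate_net) b :
  gclass c = gclass c' -> net_bigO c b -> net_bigO c' b.
Proof.
move=> /esym/gclass_eq /(@negligible_bigO _ b) H Hc.
by have := net_bigOD H Hc; rewrite -/(mnet _) -[X in net_bigO X]/(mnet (c' - c + c)) subrK.
Qed.

Lemma gval_class (c : moderate_net) : gval (gclass c) = net_val c.
Proof.
rewrite /gval /net_val; congr (ereal_sup (_ @` _)); apply/seteqP.
by split => b; apply: gclass_bigO; rewrite greprK.
Qed.

Lemma net_val_le (c : net) b : net_bigO c b -> (b%:E <= net_val c)%E.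
Proof. by move=> Hb; apply: ereal_sup_ubound; exists b. Qed.

Lemma net_val_lt (c : net) b : (b%:E < net_val c)%E -> net_bigO c b.
Proof.
move=> /ereal_sup_gt[_ [b' Hb' <-]]; rewrite lte_fin => bb'.
exact: net_bigO_le (ltW bb') Hb'.
Qed.

Lemma gval_gtNy (c : gencomplex) : (-oo < gval c)%E.
Proof.
have /moderateP[N HN] := mnetP (grepr c).
by apply: lt_le_trans (net_val_le HN); rewrite ltNyr.
Qed.

Lemma gval_eqy (c : gencomplex) : gval c = +oo%E -> c = 0.
Proof.
move=> cy; rewrite -(greprK c) -gclass0.
apply/gclass_eq; rewrite subr0; apply/negligibleP => q.
by apply: net_val_lt; rewrite -/(gval c) cy ltry.
Qed.

Lemma gval0 : gval 0 = +oo%E.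
Proof.
rewrite -gclass0 gval_class; apply/eqyP => b b0.
exact/net_val_le/net_bigO0.
Qed.

Lemma net_valN (c : net) : net_val (- c) = net_val c.
Proof.
rewrite /net_val; congr (ereal_sup (_ @` _)); apply/seteqP.
by split => b /net_bigON; rewrite ?opprK.
Qed.

Lemma gvalN (c : gencomplex) : gval (- c) = gval c.
Proof. by rewrite -[in LHS](greprK c) -gclassN gval_class net_valN. Qed.

Lemma lee_dense (x y : \bar R) :
  (forall r : R, (r%:E < x)%E -> (r%:E <= y)%E) -> (x <= y)%E.
Proof.
case: x => [r| |] H; last by rewrite leNye.
- apply/lee_addgt0Pr => e e0; rewrite -leeBlDr// -EFinB; apply: H.
  by rewrite lte_fin ltrBlDr ltrDl.
- by rewrite leye_eq; apply/eqP/eqyP => r r0; apply: H; rewrite ltry.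
Qed.

Lemma gvalD (c c' : gencomplex) :
  (Order.min (gval c) (gval c') <= gval (c + c')%R)%E.
Proof.
apply: lee_dense => b; rewrite lt_min => /andP[/net_val_lt bc /net_val_lt bc'].
rewrite -(greprK c) -(greprK c') -gclassD gval_class.
exact/net_val_le/net_bigOD.
Qed.

Lemma enormE (c : gencomplex) : (enorm c)%:E = expeR (- gval c)%E.
Proof.
rewrite /enorm fineK//; have := gval_gtNy c.
by case: (gval c).
Qed.

Lemma enorm0 : enorm 0 = 0.
Proof. by rewrite /enorm gval0. Qed.

Lemma enorm_ge0 c : 0 <= enorm c.
Proof. by rewrite -lee_fin enormE expeR_ge0. Qed.

Lemma enorm_eq0 c : enorm c = 0 -> c = 0.
Proof.
move=> c0; have /eqP : (enorm c)%:E = 0%E by rewrite c0.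
rewrite enormE expeR_eq0 => /eqP {}c0.
by apply: gval_eqy; rewrite -[LHS]oppeK c0.
Qed.

Lemma enormN c : enorm (- c) = enorm c.
Proof. by rewrite /enorm gvalN. Qed.

Lemma enormD c c' : enorm (c + c') <= Num.max (enorm c) (enorm c').
Proof.
rewrite -lee_fin EFin_max !enormE le_max !lee_expeR !leeN2 -ge_min.
exact: gvalD.
Qed.

Definition edist (c d : gencomplex) : R := enorm (c - d).

Fact edistxx c : edist c c = 0.
Proof. by rewrite /edist subrr enorm0. Qed.

Fact edist_eq0 c d : edist c d = 0 -> c = d.
Proof. by move=> /enorm_eq0/eqP; rewrite subr_eq0 => /eqP. Qed.

Fact edistC c d : edist c d = edist d c.
Proof. by rewrite /edist -opprB enormN. Qed.

Fact edist_ultra d c f : edist c f <= Num.max (edist c d) (edist d f).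
Proof. by rewrite /edist -(subrKA d c) enormD. Qed.

Fact edist_triangle d c f : edist c f <= edist c d + edist d f.
Proof.
rewrite (le_trans (edist_ultra d c f))// ge_max.
by rewrite lerDl lerDr !enorm_ge0.
Qed.

HB.instance Definition _ :=
  @isMetric.Build R gencomplex edist edistxx edist_eq0 edistC edist_triangle.

(* the net `(e ^ b)_e` *)
Definition pow_net (b : R) : net := fun e => (sval e `^ b)%:C.

Lemma pow_net_bigO b : net_bigO (pow_net b) b.
Proof.
exists 1, 1; split => // e _; rewrite mul1r /pow_net /normc /=.
by rewrite expr0n addr0 sqrtr_sqr ger0_norm ?powR_ge0.
Qed.

Fact pow_net_moderate b : pow_net b \in moderate.
Proof.
apply/moderateP; exists (Num.bound `|b|).
apply: net_bigO_le (pow_net_bigO b).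
rewrite lerNl (le_trans (ler_norm (- b)))// normrN.
by rewrite ltW// archi_boundP.
Qed.

Definition gpow (b : R) : gencomplex := gclass (ModerateNet (pow_net_moderate b)).

End Nets.

(* A plain record rather than an HB structure: HB rejects any join of
   `Topological` and `GRing.Lmodule K` unless `K` is a `numDomainType`. *)
Record topologicalGmodType (R : realType) := TopologicalGmod {
  tgm_base : PreTopologicalZmodule.type ;
  tgm_lmod : GRing.Zmodule_isLmodule (gencomplex R) tgm_base ;
  tgm_add_continuous : continuous (fun x : tgm_base * tgm_base => x.1 + x.2) ;
  tgm_scale_continuous : continuous (fun z : gencomplex R * tgm_base =>
    GRing.Zmodule_isLmodule.scale tgm_lmod z.1 z.2) }.

Section TopologicalGmodule.
Variables (R : realType) (M : topologicalGmodType R).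

Definition tgm_sort : Type := tgm_base M.

HB.instance Definition _ := PreTopologicalZmodule.on tgm_sort.
HB.instance Definition _ : GRing.Zmodule_isLmodule (gencomplex R) tgm_sort :=
  tgm_lmod M.

Lemma gscale_continuous :
  continuous (fun z : gencomplex R * tgm_sort => z.1 *: z.2).
Proof. exact: (@tgm_scale_continuous R M). Qed.

HB.instance Definition _ :=
  PreTopologicalNmodule_isTopologicalNmodule.Build tgm_sort
    (@tgm_add_continuous R M).

Fact gopp_continuous : continuous (-%R : tgm_sort -> tgm_sort).
Proof.
move=> x; rewrite /continuous_at.
rewrite -(@eq_cvg _ _ _ (fun x => -1 *: x)); last by move=> y; rewrite scaleN1r.
rewrite -[- x]scaleN1r.
apply: (@continuous_comp tgm_sort (gencomplex R * tgm_sort)%type tgm_sort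
  (fun x => (-1, x)) (fun x => x.1 *: x.2)); last exact: gscale_continuous.
by apply: (@cvg_pair _ _ _ _ (nbhs (-1 : gencomplex R)));
  [exact: cvg_cst|exact: cvg_id].
Qed.

HB.instance Definition _ :=
  TopologicalNmodule_isTopologicalZmodule.Build tgm_sort gopp_continuous.

End TopologicalGmodule.

Coercion tgm_sort : topologicalGmodType >-> Sortclass.

Section Modules.
Variables (R : realType) (M : lmodType (gencomplex R)).
Implicit Types (A : set M) (b : R).

Definition balanced A : Prop :=
  forall l : gencomplex R, enorm l <= 1 -> [set l *: x | x in A] `<=` A.

Definition absorbent A : Prop :=
  forall u : M, exists a : R, forall b, b <= a ->
    [set gpow b *: x | x in A] u.

Definition gconvex A : Prop :=
  [set x + y | x in A & y in A] `<=` A /\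
  forall b, 0 <= b -> [set gpow b *: x | x in A] `<=` A.

(* Only the knots `U n` with `1 <= n` matter; `U 0` is junk. *)
Definition gstring (U : nat -> set M) : Prop :=
  [/\ forall n, (1 <= n)%N -> balanced (U n) /\ absorbent (U n),
      forall n, (1 <= n)%N -> [set x + y | x in U n.+1 & y in U n.+1] `<=` U n
    & forall n p, (1 <= n)%N -> (1 <= p)%N ->
        [set gpow (- n%:R) *: x | x in U (n + p)%N] `<=` U p].

End Modules.

Section TopologicalModules.
Variables (R : realType) (M : topologicalGmodType R).

Definition closed_string (U : nat -> set M) : Prop :=
  forall n, (1 <= n)%N -> closed (U n).

Definition topological_string (U : nat -> set M) : Prop :=
  forall n, (1 <= n)%N -> nbhs 0 (U n).

Definition barrelled : Prop :=
  forall U : nat -> set M, gstring U -> closed_string U -> topological_string U.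

Definition locally_convex : Prop :=
  forall V : set M, nbhs 0 V ->
    exists W : set M, [/\ nbhs 0 W, gconvex W & W `<=` V].

Definition metrizable : Prop :=
  exists d : M -> M -> R,
    [/\ forall x y, d x y = 0 <-> x = y,
        forall x y, d x y = d y x,
        forall x y z, d x z <= d x y + d y z
      & forall (x : M) (A : set M),
          nbhs x A <-> exists2 r, 0 < r & [set y | d x y < r] `<=` A].

(* Cauchy for the uniformity of the topological group `M` *)
Definition gcauchy (F : set_system M) : Prop :=
  x.1 - x.2 @[x --> (F, F)] --> (0 : M).

Definition gcomplete : Prop :=
  forall F : set_system M, ProperFilter F -> gcauchy F -> exists x : M, F --> x.

Definition frechet : Prop := [/\ gcomplete, metrizable & locally_convex].

End TopologicalModules.

Arguments barrelled {R} M.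
Arguments locally_convex {R} M.
Arguments metrizable {R} M.
Arguments gcomplete {R} M.
Arguments frechet {R} M.

(* Main.v *)
Require Import Defs.
From mathcomp Require Import all_boot all_order all_algebra.
From mathcomp Require Import complex.
From mathcomp Require Import all_classical all_reals all_analysis.

Import Order.TTheory GRing.Theory Num.Theory.

Local Open Scope classical_set_scope.
Local Open Scope ring_scope.

(** Pulling a base (V n) of neighborhoods of 0 in F back along T gives a string
of G, and closing its knots gives a closed string, so barrelledness makes T
nearly continuous: every closure (T @^-1` V n) is a neighborhood of 0
(closure_string, preimage_string).  Such a base made of one string exists
because the topology of F is metrizable (string_base).

Near continuity is turned into continuity by the successive approximations of
the open mapping theorem.  A point x of closure (T @^-1` V n) differs from some
z in T @^-1` V n by an element of the neighborhood closure (T @^-1` V n.+1).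
Iterating on the remainder x - z produces remainders r k in
closure (T @^-1` V (n + k)) whose images form a Cauchy sequence, the increments
T (r k) - T (r k.+1) being in V (n + k) (approximating_sequence,
string_cauchy).  Let y be the limit of the T (r k).  The r k themselves need not
converge in G, but each is a limit of points z with T z in V (n + k), so that
(r k - z, T (r k) - T z) lies on the graph and can be brought near (0, y).  The
graph being closed, y = 0 (closed_graph_limit0).  Hence T x, which is the sum of
all the increments, stays in V n up to a shift of the index
(closure_preimage_string), and T is continuous at 0. *)

(** * The valuation of generalized numbers *)

Section Valuation.
Context {R : realType}.
Implicit Types (c d : gencomplex R) (b r s : R).

Lemma gpowD b b' : gpow (b + b') = gpow b * gpow b' :> gencomplex R.
Proof.
rewrite /gpow -gclassM; congr gclass; apply: val_inj; apply/funext => e /=.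
have /andP[e0 _] := svalP e.
rewrite /pow_net powRD ?(gt_eqF e0) ?implybT//.
exact: (rmorphM (real_complex R)).
Qed.

(** Multiplying by a class sidesteps the construction of the unit of the
quotient: gclass 1 is neutral, hence equal to 1. *)
Lemma gclass1 : gclass 1 = 1 :> gencomplex R.
Proof. by rewrite -[LHS]mulr1 -[X in _ * X]greprK -gclassM mul1r greprK. Qed.

Lemma gpow0 : gpow 0 = 1 :> gencomplex R.
Proof.
rewrite -gclass1; congr gclass; apply: val_inj; apply/funext => e /=.
by rewrite /pow_net powRr0.
Qed.

Lemma gval_gpow b : (b%:E <= gval (gpow b))%E.
Proof. by rewrite gval_class; apply/net_val_le/pow_net_bigO. Qed.

Lemma gvalM c d r s : (r%:E <= gval c)%E -> (s%:E <= gval d)%E ->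
  ((r + s)%:E <= gval (c * d)%R)%E.
Proof.
move=> rc sd; apply: lee_dense => t; rewrite lte_fin => trs.
(* the valuation is a supremum that need not be attained: the slack r + s - t
   is shared between the two factors *)
pose h := (r + s - t) / 2.
have h0 : 0 < h by rewrite divr_gt0// subr_gt0.
have rc' : net_bigO (grepr c) (r - h).
  by apply/net_val_lt; rewrite (lt_le_trans _ rc)// lte_fin ltrBlDr ltrDl.
have sd' : net_bigO (grepr d) (s - h).
  by apply/net_val_lt; rewrite (lt_le_trans _ sd)// lte_fin ltrBlDr ltrDl.
have -> : t = (r - h) + (s - h).
  by rewrite addrACA -opprD -splitr opprB addrC subrK.
rewrite -(greprK c) -(greprK d) -gclassM gval_class.
exact/net_val_le/net_bigOM.
Qed.

Lemma enorm_le_expR c r : (enorm c <= expR (- r)) = (r%:E <= gval c)%E.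
Proof.
by rewrite -lee_fin enormE -[(expR _)%:E]/(expeR (- r%:E)%E) lee_expeR leeN2.
Qed.

Lemma enorm_gpow b : enorm (gpow b : gencomplex R) <= expR (- b).
Proof. by rewrite enorm_le_expR gval_gpow. Qed.

Lemma enorm1 : enorm (1 : gencomplex R) <= 1.
Proof. by rewrite -gpow0 (le_trans (enorm_gpow 0))// oppr0 expR0. Qed.

Lemma enormM c d : enorm (c * d) <= enorm c * enorm d.
Proof.
(* a nonzero norm is an exponential, which reduces the claim to valuations *)
have expN (x : gencomplex R) : x = 0 \/ enorm x = expR (- (- ln (enorm x))).
  have [/enorm_eq0|x0] := eqVneq (enorm x) 0; [by left|right].
  by rewrite opprK lnK// posrE lt_neqAle eq_sym x0 enorm_ge0.
have [->|ec] := expN c; first by rewrite mul0r enorm0 mul0r.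
have [->|ed] := expN d; first by rewrite mulr0 enorm0 mulr0.
rewrite [X in _ <= X * _]ec [X in _ <= _ * X]ed -expRD -opprD enorm_le_expR.
by apply: gvalM; rewrite -enorm_le_expR -?ec -?ed.
Qed.

Lemma nbhs0_enorm (D : set (gencomplex R)) : nbhs 0 D ->
  exists b : R, forall c, enorm c <= expR (- b) -> D c.
Proof.
move=> /nbhs_ballP[e/= e0 eD]; exists (- ln (e / 2)) => c ce; apply: eD.
rewrite /ball/= /Defs.edist sub0r enormN (le_lt_trans ce)//.
rewrite opprK lnK ?posrE ?divr_gt0//.
by rewrite ltr_pdivrMr// ltr_pMr// ltr1n.
Qed.

End Valuation.

(** * Neighborhoods of 0 in a topological module *)

Section TopologicalModule.
Context {R : realType} {M : topologicalGmodType R}.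
Implicit Types (c : gencomplex R) (A B V : set M).

Lemma scale_continuous c : continuous ( *:%R c : M -> M).
Proof.
move=> x.
apply: (@continuous_comp M (gencomplex R * M)%type M (fun x => (c, x))
  (fun z => z.1 *: z.2)); last exact: gscale_continuous.
by apply: (@cvg_pair _ _ _ _ (nbhs (c : gencomplex R)));
  [exact: cvg_cst|exact: cvg_id].
Qed.

Lemma nbhs0_scale c V : nbhs 0 V -> nbhs 0 [set x | V (c *: x)].
Proof. by move=> V0; apply: (@scale_continuous c 0); rewrite scaler0. Qed.

Lemma nbhs0_add V : nbhs 0 V ->
  exists2 W : set M, nbhs 0 W & forall x y, W x -> W y -> V (x + y).
Proof.
move=> V0; have := @add_continuous M (0, 0) V.
rewrite /= addr0 => /(_ V0)[[W1 W2]/= [W10 W20] WV].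
exists (W1 `&` W2); first exact: filterI.
by move=> x y [W1x _] [_ W2y]; exact: (WV (x, y)).
Qed.

Lemma nbhs0_scale_small V : nbhs 0 V -> exists (b : R) (W : set M),
  nbhs 0 W /\ forall c x, enorm c <= expR (- b) -> W x -> V (c *: x).
Proof.
move=> V0; have := @gscale_continuous R M (0, 0) V.
rewrite /= scaler0 => /(_ V0)[[D W]/= [/nbhs0_enorm[b bD] W0] DWV].
by exists b, W; split=> // c x /bD cD Wx; exact: (DWV (c, x)).
Qed.

Lemma nbhs0_absorbent V : nbhs 0 V -> absorbent V.
Proof.
move=> V0 u; have := @gscale_continuous R M (0, u) V.
rewrite /= scale0r => /(_ V0)[[D W]/= [/nbhs0_enorm[a aD] Wu] DWV].
exists (- a) => b ba; exists (gpow (- b) *: u); last first.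
  by rewrite scalerA -gpowD subrr gpow0 scale1r.
apply: (DWV (gpow (- b), u)); split=> /=; last exact: nbhs_singleton.
apply: aD; rewrite (le_trans (enorm_gpow _))// opprK.
by rewrite ler_expR.
Qed.

(** The balanced core of V, made of the x whose multiples by the unit ball all
stay in V, is a neighborhood of 0: a factor c of norm at most 1 is split as
(c * gpow b) * gpow (- b), where gpow b makes the first factor small uniformly
in c, while gpow (- b) is a fixed scalar. *)
Lemma nbhs0_balanced V : nbhs 0 V ->
  exists B, [/\ nbhs 0 B, balanced B & B `<=` V].
Proof.
move=> V0; exists [set x | forall c, enorm c <= 1 -> V (c *: x)]; split.
- have [b [W [W0 WV]]] := nbhs0_scale_small V V0.
  apply: filterS (nbhs0_scale (gpow (- b)) W W0) => x /= Wx c c1.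
  have -> : c *: x = (c * gpow b) *: (gpow (- b) *: x).
    by rewrite scalerA -mulrA -gpowD subrr gpow0 mulr1.
  apply: WV => //; rewrite (le_trans (enormM _ _))//.
  rewrite (le_trans _ (enorm_gpow b))// -[leRHS]mul1r.
  by rewrite ler_wpM2r// enorm_ge0.
- move=> l l1 _ [x Vx <-] c c1 /=; rewrite scalerA; apply: Vx.
  by rewrite (le_trans (enormM _ _))// mulr_ile1// enorm_ge0.
- by move=> x /(_ 1 enorm1); rewrite scale1r.
Qed.

End TopologicalModule.

(** * Strings *)

Section Strings.
Context {R : realType} {M : lmodType (gencomplex R)}.
Implicit Types (A : set M) (U : nat -> set M).

Lemma balanced_opp A x : balanced A -> A x -> A (- x).
Proof.
move=> /(_ (-1)) + Ax; rewrite enormN => /(_ enorm1); apply.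
by exists x => //; rewrite scaleN1r.
Qed.

Lemma balanced_absorbent0 A : balanced A -> absorbent A -> A 0.
Proof.
move=> Abal /(_ 0)[a /(_ a (lexx a))[x Ax _]].
by apply: (Abal 0); [rewrite enorm0|exists x => //; rewrite scale0r].
Qed.

Lemma string0 U n : gstring U -> (0 < n)%N -> U n 0.
Proof. by move=> [UA _ _] /UA[]; exact: balanced_absorbent0. Qed.

Lemma string_opp U n x : gstring U -> (0 < n)%N -> U n x -> U n (- x).
Proof. by move=> [UA _ _] /UA[Ubal _]; exact: balanced_opp. Qed.

Lemma string_add U n x y :
  gstring U -> (0 < n)%N -> U n.+1 x -> U n.+1 y -> U n (x + y).
Proof. by move=> [_ UD _] n0 Ux Uy; apply: UD => //; exists x => //; exists y. Qed.

Lemma string_decreasing U n m :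
  gstring U -> (0 < n)%N -> (n <= m)%N -> U m `<=` U n.
Proof.
move=> US n0; elim: m => [|m IH]; first by rewrite leqNgt n0.
rewrite leq_eqVlt => /predU1P[->//|nm] x Ux.
apply: IH => //; rewrite -[x]addr0; apply: string_add => //.
- exact: leq_trans n0 nm.
- exact: string0.
Qed.

End Strings.

Lemma preimage_string (R : realType) (M N : lmodType (gencomplex R))
    (T : {linear M -> N}) (U : nat -> set N) :
  gstring U -> gstring (fun n => T @^-1` U n).
Proof.
move=> [UA UD UZ]; split.
- move=> n /UA[Ubal Uabs]; split.
  + move=> l l1 _ [x Ux <-] /=; rewrite linearZ.
    by apply: (Ubal l l1); exists (T x).
  + move=> u; have [a ha] := Uabs (T u); exists a => b /ha[v Uv vu].
    exists (gpow (- b) *: u); last first.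
      by rewrite scalerA -gpowD subrr gpow0 scale1r.
    rewrite /= linearZ -vu /= scalerA -gpowD addNr gpow0.
    by rewrite scale1r.
- move=> n n1 _ [x Ux [y Uy <-]] /=; rewrite linearD.
  by apply: UD => //; exists (T x) => //; exists (T y).
- move=> n p n1 p1 _ [x Ux <-] /=; rewrite linearZ.
  by apply: (UZ n p) => //; exists (T x).
Qed.

Section TopologicalStrings.
Context {R : realType} {M : topologicalGmodType R}.
Implicit Types (c : gencomplex R) (A B : set M) (U : nat -> set M).

Lemma closure_scale c A x :
  closure A x -> closure [set c *: y | y in A] (c *: x).
Proof.
move=> clA B Bx; have [y [Ay By]] := clA _ (scale_continuous c x B Bx).
by exists (c *: y); split => //; exists y.
Qed.

Lemma closure_add A B x y : closure A x -> closure B y ->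
  closure [set x + y | x in A & y in B] (x + y).
Proof.
move=> clA clB C /(@add_continuous M (x, y))[[X Y]/= [/clA + /clB +] XYC].
move=> [x' [Ax' Xx']] [y' [By' Yy']]; exists (x' + y'); split.
  by exists x' => //; exists y'.
exact: (XYC (x', y')).
Qed.

Lemma closure_string U : gstring U -> gstring (fun n => closure (U n)).
Proof.
move=> [UA UD UZ]; split.
- move=> n /UA[Ubal Uabs]; split.
  + move=> l l1 _ [x Ux <-].
    exact: closureS (Ubal l l1) _ (closure_scale _ _ _ Ux).
  + move=> u; have [a ha] := Uabs u; exists a => b /ha[v Uv vu].
    by exists v => //; exact: subset_closure.
- move=> n n1 _ [x Ux [y Uy <-]].
  exact: closureS (UD n n1) _ (closure_add _ _ _ _ Ux Uy).
- move=> n p n1 p1 _ [x Ux <-].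
  exact: closureS (UZ n p n1 p1) _ (closure_scale _ _ _ Ux).
Qed.

(** One step in the construction of a topological string: W can follow V as a
knot.  The factor gpow (- n) between the knots of index n + p and p is the
product of n factors gpow (- 1), so only the latter is asked for. *)
Lemma nbhs0_knot V B : nbhs (0 : M) V -> nbhs (0 : M) B ->
  exists W : set M, [/\ nbhs 0 W, balanced W & W `<=` [set x | B x /\
    (forall y, W y -> V (x + y)) /\ V (gpow (- 1) *: x)]].
Proof.
move=> V0 B0; have [W1 W10 W1V] := nbhs0_add V V0.
have [W [W0 Wbal WW]] := nbhs0_balanced _
  (filterI (filterI W10 B0) (nbhs0_scale (gpow (- 1)) V V0)).
exists W; split=> // x Wx; have [[W1x Bx] Vx] := WW _ Wx.
by split=> //; split=> // y /WW[[W1y _] _]; exact: W1V.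
Qed.

(** Below any sequence of neighborhoods of 0 lies a topological string. *)
Lemma string_base (B : nat -> set M) : (forall n, nbhs (0 : M) (B n)) ->
  exists V : nat -> set M,
    [/\ gstring V, topological_string V & forall n, V n.+1 `<=` B n].
Proof.
move=> B0.
have [f fP] : exists f : nat -> set M -> set M, forall n V, nbhs 0 V ->
    [/\ nbhs 0 (f n V), balanced (f n V) & f n V `<=` [set x | B n x /\
      (forall y, f n V y -> V (x + y)) /\ V (gpow (- 1) *: x)]].
  have /choice[f fP] : forall nV : nat * set M, exists W : set M,
      nbhs 0 nV.2 ->
      [/\ nbhs 0 W, balanced W & W `<=` [set x | B nV.1 x /\
        (forall y, W y -> nV.2 (x + y)) /\ nV.2 (gpow (- 1) *: x)]].
    move=> [n V]; have [V0|?] := pselect (nbhs 0 V); last by exists setT.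
    by have [W ?] := nbhs0_knot V (B n) V0 (B0 n); exists W.
  by exists (fun n V => f (n, V)) => n V; exact: (fP (n, V)).
pose V := fix V n := if n is m.+1 then f m (V m) else setT.
have V0 n : nbhs 0 (V n).
  by elim: n => [|n /(fP n)[]//]; exact: filterT.
have VS n : V n.+1 `<=` [set x | B n x /\
    (forall y, V n.+1 y -> V n (x + y)) /\ V n (gpow (- 1) *: x)].
  by have [] := fP n _ (V0 n).
exists V; split; last by move=> n x /VS[].
- split.
  + case=> // n _; split; first by have [] := fP n _ (V0 n).
    exact: nbhs0_absorbent.
  + by move=> n _ _ [x Vx [y Vy <-]]; have [_ [+ _]] := VS _ _ Vx; exact.
  + move=> n p _ _ _ [x + <-]; elim: n x => [|n IH] x.
      by rewrite oppr0 gpow0 scale1r.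
    rewrite addSn => /VS[_ [_ /IH]].
    by rewrite scalerA -gpowD -opprD -natr1.
- by move=> n _; exact: V0.
Qed.

Lemma metrizable_base : metrizable M -> exists B : nat -> set M,
  (forall n, nbhs (0 : M) (B n)) /\
  forall A, nbhs (0 : M) A -> exists n, B n `<=` A.
Proof.
move=> [d [_ _ _ dP]]; exists (fun n => [set y | d 0 y < n.+1%:R^-1]); split.
  by move=> n; apply/dP; exists n.+1%:R^-1 => //; rewrite invr_gt0 ltr0n.
move=> A /dP[r r0 rA]; exists (Num.bound r^-1) => y /= dy; apply: rA => /=.
apply: (lt_trans dy); rewrite invf_plt ?posrE ?ltr0n//.
have /archi_boundP rb : 0 <= r^-1 by rewrite invr_ge0 ltW.
by rewrite (lt_trans rb)// ltr_nat.
Qed.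

End TopologicalStrings.

Lemma linear_continuous0 {R : realType} {G F : topologicalGmodType R}
    (T : {linear G -> F}) :
  (forall A, nbhs (0 : F) A -> nbhs (0 : G) (T @^-1` A)) -> continuous T.
Proof.
move=> T0 x A; rewrite -{1}[T x]addr0.
move=> /(@add_continuous F (T x, 0))[[X Y]/= [Xx /T0 TY] XYA].
have := @add_continuous G (x, - x) (T @^-1` Y).
rewrite /= subrr => /(_ TY)[[P Q]/= [Px Qx] PQY].
apply: filterS Px => y Py /=.
have -> : T y = T x + T (y - x) by rewrite linearB addrC subrK.
apply: (XYA (T x, _)); split=> /=; first exact: nbhs_singleton.
by apply: (PQY (y, - x)); split=> //=; exact: nbhs_singleton.
Qed.

(** * The closed graph argument *)

Section ClosedGraph.
Context {R : realType} {G F : topologicalGmodType R} (T : {linear G -> F}).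
Context (V : nat -> set F).
Context (Vstring : gstring V).
Context (Vtop : topological_string V).
Context (Vbase : forall A, nbhs (0 : F) A -> exists2 n, (0 < n)%N & V n `<=` A).
Context (Tgraph : closed [set p : G * F | p.2 = T p.1]).
Context (Tnear : topological_string (fun n => closure (T @^-1` V n))).

Lemma closure_preimage_step n r : (0 < n)%N -> closure (T @^-1` V n) r ->
  exists r', closure (T @^-1` V n.+1) r' /\ V n (T r - T r').
Proof.
move=> n0 clr; have := @sub_continuous G (r, r) (closure (T @^-1` V n.+1)).
rewrite /= subrr => /(_ (Tnear n.+1 isT))[[X Y]/= [Xr Yr] XYcl].
have [z [Vz Yz]] := clr _ Yr.
exists (r - z); split.
  by apply: (XYcl (r, z)); split=> //=; exact: nbhs_singleton.
by rewrite linearB subKr.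
Qed.

Lemma approximating_sequence n x : (0 < n)%N -> closure (T @^-1` V n) x ->
  exists r : nat -> G, [/\ r 0%N = x,
    forall k, closure (T @^-1` V (n + k)%N) (r k) &
    forall k, V (n + k)%N (T (r k) - T (r k.+1))].
Proof.
move=> n0 clx.
have /choice[f fP] : forall kr : nat * G, exists r',
    closure (T @^-1` V (n + kr.1)%N) kr.2 ->
    closure (T @^-1` V (n + kr.1).+1) r' /\ V (n + kr.1)%N (T kr.2 - T r').
  move=> [k r] /=.
  have [clr|?] := pselect (closure (T @^-1` V (n + k)%N) r); last by exists 0.
  have [r' ?] := closure_preimage_step (n + k) r (ltn_addr k n0) clr.
  by exists r'.
pose r := fix r k := if k is j.+1 then f (j, r j) else x.
have rcl k : closure (T @^-1` V (n + k)%N) (r k).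
  by elim: k => [|k IH]; [rewrite addn0|rewrite addnS; apply (fP (k, r k))].
by exists r; split=> // k; apply (fP (k, r k)).
Qed.

(** The knots halve, as the sets of a geometric series do: a sum of increments
taken in successive knots stays in the knot that precedes the first of them. *)
Lemma string_telescope (y : nat -> F) n : (0 < n)%N ->
  (forall k, V (n.+1 + k)%N (y k - y k.+1)) ->
  forall k j, V (n + k)%N (y k - y (k + j)%N).
Proof.
move=> n0 yV k j; elim: j k => [|j IH] k.
  by rewrite addn0 subrr; apply: string0 => //; rewrite addn_gt0 n0.
rewrite addnS -addSn -(subrKA (y k.+1)); apply: string_add => //.
- by rewrite addn_gt0 n0.
- by rewrite -addSn; exact: yV.
- by rewrite -addnS; exact: IH.
Qed.

Lemma string_cauchy (y : nat -> F) n : (0 < n)%N ->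
  (forall k j, V (n + k)%N (y k - y (k + j)%N)) -> gcauchy (y @ \oo).
Proof.
move=> n0 yV A /Vbase[m m0 VA].
have tail : (y @ \oo) [set z | exists2 k, (m <= k)%N & z = y k].
  by exists m => // k mk; exists k.
exists ([set z | exists2 k, (m <= k)%N & z = y k],
        [set z | exists2 k, (m <= k)%N & z = y k]) => //=.
move=> [_ _]/= [[k mk ->] [l ml ->]]; apply: VA.
have yVm i j : (m <= i)%N -> V m (y i - y (i + j)%N).
  move=> mi; apply: string_decreasing (yV i j) => //.
  by rewrite (leq_trans mi)// leq_addl.
have [kl|/ltnW lk] := leqP k l; first by rewrite -(subnKC kl); exact: yVm.
by rewrite -opprB; apply: string_opp => //; rewrite -(subnKC lk); exact: yVm.
Qed.

(** The remainders r k need not tend to 0 in G, since the knots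
closure (T @^-1` V n) are no base of neighborhoods there.  Each r k is instead
replaced by r k - z with z near r k and T z in V (n + k), which moves
T (r k) by an amount that tends to 0. *)
Lemma closed_graph_limit0 (r : nat -> G) n y : (0 < n)%N ->
  (forall k, closure (T @^-1` V (n + k)%N) (r k)) ->
  T (r k) @[k --> \oo] --> y -> y = 0.
Proof.
move=> n0 rcl Try.
have : closure [set p : G * F | p.2 = T p.1] (0, y).
  move=> C [[P Q]/= [P0 Qy] PQC].
  have := @sub_continuous F (y, 0) Q.
  rewrite /= subr0 => /(_ Qy)[[X Y]/= [/Try Xy /Vbase[m m0 VY]] XYQ].
  have [k [mk Xk]] : exists k, (m <= k)%N /\ X (T (r k)).
    have [N _ NX] := Xy; exists (maxn m N); split; first exact: leq_maxl.
    by apply: NX => /=; exact: leq_maxr.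
  have := @sub_continuous G (r k, r k) P.
  rewrite /= subrr => /(_ P0)[[X' Y']/= [Xr Yr] XYP].
  have [z [Vz Yz]] := rcl k _ Yr.
  exists (r k - z, T (r k - z)); split=> //; apply: PQC; split=> /=.
    by apply: (XYP (r k, z)); split=> //=; exact: nbhs_singleton.
  rewrite linearB; apply: (XYQ (T (r k), T z)); split=> //=; apply: VY.
  apply: string_decreasing Vz => //.
  by rewrite (leq_trans mk)// leq_addl.
by rewrite -((closure_id _).1 Tgraph) /= linear0.
Qed.

(** The shift by 2 pays for two additions: one for the sum of the increments,
one for the last remainder T (r N). *)
Lemma closure_preimage_string : gcomplete F -> forall n, (0 < n)%N ->
  closure (T @^-1` V n.+2) `<=` T @^-1` V n.
Proof.
move=> Fcomplete n n0 x clx.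
have [r [r0 rcl rV]] := approximating_sequence n.+2 x isT clx.
have rtel := string_telescope (T \o r) n.+1 isT rV.
have [y Try] := Fcomplete _ _ (string_cauchy _ _ (ltn0Sn n) rtel).
move: (Try); rewrite (closed_graph_limit0 r n.+2 y isT rcl Try) => Tr0.
have [N _ /(_ N (leqnn N)) TrV] := Tr0 _ (Vtop n.+1 isT).
rewrite /= -(subrK (T (r N)) (T x)); apply: string_add => //.
by have := rtel 0%N N; rewrite addn0 add0n /= r0.
Qed.

End ClosedGraph.

Theorem theorem3p16 (R : realType) (G F : topologicalGmodType R)
    (hG : barrelled G) (hF : frechet F) (T : {linear G -> F})
    (hT : closed [set p : G * F | p.2 = T p.1]) :
  continuous T.
Proof.
have [Fcomplete /metrizable_base[B [B0 Bbase]] _] := hF.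
have [V [Vstring Vtop VB]] := string_base B B0.
have Vbase A : nbhs (0 : F) A -> exists2 n, (0 < n)%N & V n `<=` A.
  by move=> /Bbase[n BA]; exists n.+1 => //; exact: subset_trans BA.
have Tnear : topological_string (fun n => closure (T @^-1` V n)).
  apply: hG; first exact/closure_string/preimage_string.
  by move=> n _; exact: closed_closure.
apply: linear_continuous0 => A /Vbase[n n0 VA].
apply: filterS (Tnear n.+2 isT) => x clx; apply: VA.
exact: (closure_preimage_string T V Vstring Vtop Vbase hT Tnear Fcomplete
  n n0 x clx).
Qed.
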